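(* Let $F$ be a finite simple graph with maximum degree $\Delta \geq 1$, and let $G$ be a $k$-fold cover of $F$. Then $\gamma(G) \geq \frac{1}{H(\Delta)}\,k\,\gamma(F)$, where $H(\Delta) = 1 + \frac{1}{2} + \frac{1}{3} + \cdots + \frac{1}{\Delta}$.
   Context: All graphs are finite, simple and undirected. A graph $G$ is a cover of a graph $F$ if there is an onto map $\pi: V(G)\to V(F)$ such that for every vertex $v$ of $G$, $\pi$ maps the neighbours of $v$ in $G$ bijectively onto the neighbours of $\pi(v)$ in $F$; the cover is $k$-fold if every fibre $\pi^{-1}(u)$ has exactly $k$ vertices. (Degrees are preserved by $\pi$, so $G$ and $F$ have the same maximum degree $\Delta$.) $\gamma(\cdot)$ denotes the domination number: the minimum size of a set $S$ of vertices such that every vertex not in $S$ has a neighbour in $S$. *)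

(* Defs.v *)
From mathcomp Require Import all_boot all_order all_algebra.
Set Implicit Arguments. Unset Strict Implicit. Unset Printing Implicit Defensive.
Import Order.TTheory GRing.Theory Num.Theory.

Definition simple_graph (T : finType) (e : rel T) : Prop :=
  symmetric e /\ irreflexive e.

Definition nbhd (T : finType) (e : rel T) (v : T) : {set T} := [set u | e v u].

Definition max_degree (T : finType) (e : rel T) : nat :=
  \max_(v : T) #|nbhd e v|.

Definition dominating (T : finType) (e : rel T) (S : {set T}) : bool :=
  [forall v, (v \notin S) ==> [exists u in S, e v u]].

(* domination number: minimum size of a dominating set
   (setT is always dominating, so the minimum exists) *)
Definition domination_number (T : finType) (e : rel T) : nat :=
  \big[minn/#|T|]_(S : {set T} | dominating e S) #|S|.

Definition is_cover (TG TF : finType) (eG : rel TG) (eF : rel TF)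
  (pi : TG -> TF) : Prop :=
  (forall u : TF, exists v : TG, pi v = u) /\
  (forall v : TG,
     {in nbhd eG v &, injective pi} /\ pi @: nbhd eG v = nbhd eF (pi v)).

Definition is_kfold_cover (k : nat) (TG TF : finType) (eG : rel TG)
  (eF : rel TF) (pi : TG -> TF) : Prop :=
  is_cover eG eF pi /\ forall u : TF, #|[set v | pi v == u]| = k.

Definition harmonic (n : nat) : rat := \sum_(1 <= i < n.+1) (i%:R)^-1.

(* Main.v *)
Require Import Defs.
From mathcomp Require Import all_boot all_order all_algebra.
From mathcomp Require Import zify lra.
Set Implicit Arguments. Unset Strict Implicit. Unset Printing Implicit Defensive.
Import Order.TTheory GRing.Theory Num.Theory.
Local Open Scope ring_scope.

(** Projecting a dominating set S of G to F, the weights |S ∩ fibre of u| / k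
    form a fractional dominating set of F. By duality it suffices to find a
    dominating set D of F and nonnegative prices p on the vertices, of total at
    least |D|, such that every closed neighbourhood costs at most H(Δ).

    The greedy algorithm, with each step charged evenly to the newly covered
    vertices, only gives H(Δ + 1), since closed neighbourhoods have up to Δ + 1
    elements. The missing 1/(Δ + 1) is gained as follows.
    - Once every closed neighbourhood meets the uncovered set in at most two
      vertices, covering the rest optimally is an edge cover problem, for which
      a pair can be charged 4/3 instead of 1 + 1/2. This gains 1/6, which is
      enough for Δ >= 5.
    - For Δ = 4, moreover, a greedy step that covers 5 or 4 new vertices has an
      uncovered centre, and charging its centre and its neighbours unequally
      gains the rest.
    - For Δ <= 3, the vertices are partitioned into the least possible number
      of stars, without trivial stars except at isolated vertices. Prices 1/2
      suffice for Δ <= 2. For Δ = 3, stars with at least three vertices pay 1/3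
      per vertex and pairs pay 1/2 per vertex; local optimality allows moving
      1/12 inside a pair whenever some neighbourhood would cost 2. *)

(** * The domination number as an attained minimum *)

Lemma bigminn_le (I : eqType) (m : nat) (F : I -> nat) (P : pred I)
    (r : seq I) (j : I) :
  j \in r -> P j -> (\big[minn/m]_(i <- r | P i) F i <= F j)%N.
Proof.
elim: r => // i r IH; rewrite inE => /orP[/eqP-> Pj|jr Pj].
  by rewrite big_cons Pj geq_minl.
rewrite big_cons; case: (P i); last exact: IH.
by apply: leq_trans (IH jr Pj); exact: geq_minr.
Qed.

Lemma domination_number_le (T : finType) (e : rel T) (S : {set T}) :
  dominating e S -> (domination_number e <= #|S|)%N.
Proof. by move=> domS; apply: bigminn_le => //; rewrite mem_index_enum. Qed.

Lemma domination_number_attained (T : finType) (e : rel T) :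
  exists2 S : {set T}, dominating e S & #|S| = domination_number e.
Proof.
rewrite /domination_number.
elim/big_ind: _ => [|x y [A dA cA] [B dB cB]|S domS]; last by exists S.
  (* The default value [#|T|] of the minimum is the size of the dominating set [setT]. *)
  exists setT; last by rewrite cardsT.
  by apply/forallP=> v; rewrite inE.
by case: (leqP x y) => _; [exists A | exists B].
Qed.

(** * Closed neighbourhoods and packings *)

Section Graph.
Variables (T : finType) (e : rel T).
Hypothesis e_sym : symmetric e.

Definition cnbhd (v : T) : {set T} := v |: nbhd e v.

Definition covered (D : {set T}) : {set T} := \bigcup_(x in D) cnbhd x.

Lemma in_cnbhd (v u : T) : (u \in cnbhd v) = (u == v) || e v u.
Proof. by rewrite !inE. Qed.

Lemma cnbhd_sym (v u : T) : (u \in cnbhd v) = (v \in cnbhd u).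
Proof. by rewrite !in_cnbhd eq_sym e_sym. Qed.

Lemma cnbhd_refl (v : T) : v \in cnbhd v.
Proof. by rewrite in_cnbhd eqxx. Qed.

Lemma coveredP (D : {set T}) (v : T) :
  reflect (exists2 x, x \in D & v \in cnbhd x) (v \in covered D).
Proof. exact: bigcupP. Qed.

Lemma coveredU (A B : {set T}) : covered (A :|: B) = covered A :|: covered B.
Proof. exact: bigcup_setU. Qed.

Lemma dominatingP (D : {set T}) :
  reflect (forall v, v \in covered D) (dominating e D).
Proof.
apply: (iffP forallP) => [domD v|covD v].
  apply/coveredP; case: (boolP (v \in D)) => [vD|vND].
    by exists v; rewrite ?cnbhd_refl.
  have /exists_inP[x xD evx] := implyP (domD v) vND.
  by exists x; rewrite // in_cnbhd e_sym evx orbT.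
apply/implyP => vND; have /coveredP[x xD] := covD v.
rewrite in_cnbhd => /orP[/eqP vx|exv]; first by rewrite vx xD in vND.
by apply/exists_inP; exists x => //; rewrite e_sym.
Qed.

Lemma card_cnbhd (v : T) : (#|cnbhd v| <= (max_degree e).+1)%N.
Proof.
rewrite cardsU1 -add1n; apply: leq_add; first by case: (_ \notin _).
exact: (leq_bigmax (F := fun w => #|nbhd e w|)).
Qed.

(** [R] stands for the uncovered vertices. A packing is a batch of greedy steps, each covering [g]
    new vertices; the traces on [R] are disjoint, so their order does not matter. *)
Definition is_packing (R : {set T}) (g : nat) (X : {set T}) : bool :=
  [forall x in X, #|cnbhd x :&: R| == g] &&
  [forall v in R, #|X :&: cnbhd v| <= 1]%N.

Lemma packing_trace (R : {set T}) (g : nat) (X : {set T}) (x : T) :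
  is_packing R g X -> x \in X -> #|cnbhd x :&: R| = g.
Proof. by case/andP => /forall_inP XR _ /XR/eqP. Qed.

Lemma packing_inj (R : {set T}) (g : nat) (X : {set T}) (x y v : T) :
  is_packing R g X -> x \in X -> y \in X -> v \in R ->
  v \in cnbhd x -> v \in cnbhd y -> x = y.
Proof.
case/andP => _ /forall_inP Xdisj xX yX vR vx vy.
by apply: (card_le1_eqP (Xdisj v vR)); rewrite in_setI ?xX ?yX cnbhd_sym.
Qed.

Lemma is_packingI (R : {set T}) (g : nat) (X : {set T}) :
  (forall x, x \in X -> #|cnbhd x :&: R| = g) ->
  (forall x y v, x \in X -> y \in X -> v \in R ->
     v \in cnbhd x -> v \in cnbhd y -> x = y) ->
  is_packing R g X.
Proof.
move=> XR Xdisj; apply/andP; split.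
  by apply/forall_inP => x /XR/eqP.
apply/forall_inP => v vR; apply/card_le1_eqP => x y.
rewrite !in_setI => /andP[xX vx] /andP[yX vy].
by apply: (Xdisj _ _ v); rewrite // cnbhd_sym.
Qed.

(** If a trace kept [g.+1] vertices after removal of what [X] covers, it would have lost none, and
    its centre could join [X]. Maximum cardinality, rather than maximality under inclusion, serves
    the augmentation argument for traces of size two. *)
Lemma maximum_packing (R : {set T}) (g : nat) :
  (forall u, #|cnbhd u :&: R| <= g.+1)%N ->
  exists X : {set T},
    [/\ is_packing R g.+1 X,
        forall Y, is_packing R g.+1 Y -> (#|Y| <= #|X|)%N
      & forall u, (#|cnbhd u :&: (R :\: covered X)| <= g)%N].
Proof.
move=> maxR.
have P0 : is_packing R g.+1 set0 by apply: is_packingI => x; rewrite inE.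
case: (arg_maxnP (fun X : {set T} => #|X|) P0) => X PX Xmax.
exists X; split=> // u; rewrite leqNgt; apply/negP => gu.
have sub : cnbhd u :&: (R :\: covered X) \subset cnbhd u :&: R.
  by rewrite setIS // subsetDl.
have eqg : #|cnbhd u :&: R| = g.+1.
  by apply/eqP; rewrite eqn_leq maxR (leq_trans gu) // subset_leq_card.
have eqR : cnbhd u :&: (R :\: covered X) = cnbhd u :&: R.
  by apply/eqP; rewrite eqEcard sub eqg.
have disjX x v : x \in X -> v \in R -> v \in cnbhd u -> v \in cnbhd x -> False.
  move=> xX vR vu vx; have : v \in cnbhd u :&: R by rewrite in_setI vu.
  rewrite -eqR !inE => /and3P[_ /negP vNX _].
  by apply: vNX; apply/coveredP; exists x.
have uNX : u \notin X.
  apply/negP => uX; have /card_gt0P[v] : (0 < #|cnbhd u :&: R|)%N by rewrite eqg.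
  by rewrite in_setI => /andP[vu vR]; exact: (disjX u v).
suff PU : is_packing R g.+1 (u |: X).
  by have := Xmax _ PU; rewrite /= cardsU1 uNX add1n ltnn.
apply: is_packingI => [x|x y v].
  by rewrite in_setU1 => /orP[/eqP->//|/(packing_trace PX)].
move=> /setU1P[->|xX] /setU1P[->|yX] vR vx vy //.
- by have := disjX y v yX vR vx vy.
- by have := disjX x v xX vR vy vx.
- exact: (packing_inj PX xX yX vR vx vy).
Qed.

Lemma sum_packing (R : {set T}) (g : nat) (X : {set T}) (p : T -> rat) :
  is_packing R g X ->
  \sum_(v in R :&: covered X) p v = \sum_(x in X) \sum_(v in cnbhd x :&: R) p v.
Proof.
move=> PX.
rewrite [RHS](exchange_big_dep (mem (R :&: covered X))) /=; last first.
  move=> x v xX; rewrite !in_setI => /andP[vx ->]; apply/coveredP.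
  by exists x.
apply: eq_bigr => v; rewrite in_setI => /andP[vR /coveredP[x xX vx]].
rewrite (big_pred1 x) // => y; apply/andP/eqP => [[yX]|->].
  by rewrite in_setI => /andP[vy _]; exact: (packing_inj PX yX xX vR).
by rewrite in_setI vx.
Qed.
End Graph.

(** * Harmonic numbers *)

Lemma harmonic0 : harmonic 0 = 0.
Proof. by rewrite /harmonic big_geq. Qed.

Lemma harmonicS (n : nat) : harmonic n.+1 = harmonic n + n.+1%:R^-1.
Proof. by rewrite /harmonic big_nat_recr. Qed.

(** The saving of 1/6 enters at trace size two, where 4/3 replaces 3/2, and is kept for all larger
    sizes. *)
Definition reduced_harmonic (n : nat) : rat := harmonic n - (1 < n)%:R / 6.

(** * Edge cover prices for traces of size at most two *)

Section GreedyPrices.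
Variables (T : finType) (e : rel T).
Hypothesis e_sym : symmetric e.

Local Notation N := (cnbhd e).

(** A dual certificate relative to [R]: only prices on [R] count as payment, so certificates of
    successive phases add up. *)
Definition priced_cover (R D : {set T}) (p : T -> rat) : Prop :=
  [/\ R \subset covered e D, forall v, 0 <= p v
    & #|D|%:R <= \sum_(v in R) p v].

Section SmallTraces.
Variable R : {set T}.
Hypothesis R2 : forall u, (#|N u :&: R| <= 2)%N.

Lemma trace_pair (u a b : T) :
  a != b -> a \in R -> b \in R -> a \in N u -> b \in N u ->
  N u :&: R = [set a; b].
Proof.
move=> ab aR bR au bu; apply/esym/eqP.
by rewrite eqEcard cards2 ab R2 subUset !sub1set !in_setI au bu aR bR.
Qed.

(** For distinct [a] and [b] in [R], this is adjacency in the graph on [R] whose edges are the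
    two-element traces; packings with [g = 2] are its matchings. *)
Definition share (a b : T) : bool := [exists u, (a \in N u) && (b \in N u)].

(* Otherwise x could be replaced by two centres, one for the trace {q, y} and
   one for {q', y'}: an augmenting path of length three. *)
Lemma maximum_packing_no_augment (X : {set T}) (x q q' y y' : T) :
  is_packing e R 2 X -> (forall Y, is_packing e R 2 Y -> (#|Y| <= #|X|)%N) ->
  x \in X -> y != y' -> y \in N x :&: R -> y' \in N x :&: R ->
  q \in R :\: covered e X -> q' \in R :\: covered e X ->
  share q y -> share q' y' -> q = q'.
Proof.
move=> PX Xmax xX yy' /setIP[yx yR] /setIP[y'x y'R] /setDP[qR qX] /setDP[q'R q'X].
case/existsP=> u /andP[qu yu] /existsP[u' /andP[q'u' y'u']].
apply/eqP; apply: contraT => qq'.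
have cov v z : z \in X -> v \in N z -> v \in covered e X.
  by move=> zX vz; apply/coveredP; exists z.
have qy : q != y by apply: contraNneq qX => ->; exact: cov yx.
have q'y' : q' != y' by apply: contraNneq q'X => ->; exact: cov y'x.
have qy' : q != y' by apply: contraNneq qX => ->; exact: cov y'x.
have q'y : q' != y by apply: contraNneq q'X => ->; exact: cov yx.
have tu := trace_pair qy qR yR qu yu.
have tu' := trace_pair q'y' q'R y'R q'u' y'u'.
have inu v : v \in R -> v \in N u -> (v == q) || (v == y).
  by move=> vR vu; rewrite -in_set2 -tu in_setI vu.
have inu' v : v \in R -> v \in N u' -> (v == q') || (v == y').
  by move=> vR vu; rewrite -in_set2 -tu' in_setI vu.
have uX : u \notin X by apply/negP => /cov/(_ qu) H; rewrite H in qX.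
have u'X : u' \notin X by apply/negP => /cov/(_ q'u') H; rewrite H in q'X.
have uu' : u != u'.
  apply/eqP => E; rewrite -E in y'u'; have := inu _ y'R y'u'.
  by rewrite ![y' == _]eq_sym (negbTE qy') (negbTE yy').
have dis_u z v : z \in X :\ x -> v \in R -> v \in N u -> v \in N z -> False.
  case/setD1P=> zx zX vR vu vz; case/orP: (inu v vR vu) => /eqP E; subst v.
    by move: qX; rewrite (cov _ _ zX vz).
  by move: zx; rewrite (packing_inj e_sym PX zX xX vR vz yx) eqxx.
have dis_u' z v : z \in X :\ x -> v \in R -> v \in N u' -> v \in N z -> False.
  case/setD1P=> zx zX vR vu vz; case/orP: (inu' v vR vu) => /eqP E; subst v.
    by move: q'X; rewrite (cov _ _ zX vz).
  by move: zx; rewrite (packing_inj e_sym PX zX xX vR vz y'x) eqxx.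
have dis_uu' v : v \in R -> v \in N u -> v \in N u' -> False.
  move=> vR /(inu v vR) vu /(inu' v vR) vu'.
  case/orP: vu vu' => /eqP->; first by rewrite (negbTE qq') (negbTE qy').
  by rewrite eq_sym (negbTE q'y) (negbTE yy').
have PY : is_packing e R 2 (u |: (u' |: (X :\ x))).
  apply: is_packingI => // [z|z z' v].
    rewrite !in_setU1 => /or3P[/eqP->|/eqP->|/setD1P[_ zX]].
    - by rewrite tu cards2 qy.
    - by rewrite tu' cards2 q'y'.
    - exact: (packing_trace PX zX).
  move=> /setU1P[->|/setU1P[->|zX]] /setU1P[->|/setU1P[->|z'X]] vR vz vz' //.
  - by case: (dis_uu' v).
  - by case: (dis_u z' v).
  - by case: (dis_uu' v).
  - by case: (dis_u' z' v).
  - by case: (dis_u z v).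
  - by case: (dis_u' z v).
  - have [/setD1P[_ {}zX] /setD1P[_ {}z'X]] := (zX, z'X).
    exact: (packing_inj e_sym PX zX z'X vR vz vz').
have := Xmax _ PY.
rewrite !cardsU1 !in_setU1 !in_setD1 (negbTE uu') (negbTE uX) (negbTE u'X) !andbF /=.
by rewrite (cardsD1 x X) xX ltnn.
Qed.

(** [X] is a maximum matching, and each vertex of the unmatched set [Q] is its own centre. By
    default a vertex of [Q] pays 1 and a matched vertex 2/3. A matched vertex pays 1/3 if it is the
    only end of its edge adjacent to [Q] ([lone]); a vertex of [Q] pays 2/3 if it forms a triangle
    with an edge of [X] ([tri]). *)
Lemma edge_cover_prices :
  exists D p, priced_cover R D p /\
    forall u, \sum_(v in N u :&: R) p v <= reduced_harmonic #|N u :&: R|.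
Proof.
have [X [PX Xmax Xleft]] := maximum_packing e_sym R2.
set Q := R :\: covered e X in Xleft *.
have noaug x q q' y y' := @maximum_packing_no_augment X x q q' y y' PX Xmax.
pose adj v := [exists q in Q, share q v].
pose tri q := [exists x in X, [forall v in N x :&: R, share q v]].
pose lone v := adj v && [exists x in X, (v \in N x) &&
   [forall w in N x :&: R, adj w ==> (w == v)]].
pose p v : rat := if v \in Q then (if tri v then 2/3 else 1)
                  else (if lone v then 1/3 else 2/3).
have pge v : 1/3 <= p v by rewrite /p; case: ifP; case: ifP => _ _; lra.
have ple v : p v <= 1 by rewrite /p; case: ifP; case: ifP => _ _; lra.
exists (X :|: Q), p; split; first split.
- rewrite coveredU; apply/subsetP => v vR; rewrite in_setU.
  case: (boolP (v \in covered e X)) => //= vX; apply/coveredP.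
  by exists v; rewrite ?cnbhd_refl // in_setD vX.
- by move=> v; have := pge v; lra.
- pose Qt := [set q in Q | tri q].
  pose Xt := [set x in X | [forall v in N x :&: R, adj v]].
  (* By the augmentation argument distinct [tri] vertices select distinct edges of [X], so the 1/3
     missing at each is made up by an edge in [Xt]. *)
  have QX : (#|Qt| <= #|Xt|)%N.
    pose f q := odflt q [pick x in X | [forall v in N x :&: R, share q v]].
    have fP q : q \in Qt -> f q \in X /\ forall v, v \in N (f q) :&: R -> share q v.
      rewrite inE => /andP[_ /exists_inP[x xX xt]]; rewrite /f.
      case: pickP => [z /andP[zX /forall_inP zt]|/(_ x)]; last by rewrite xX xt.
      by split.
    rewrite -(card_in_imset (f := f)).
      apply/subset_leq_card/subsetP => x /imsetP[q qQt ->].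
      have [fX ft] := fP q qQt; rewrite inE fX; apply/forall_inP => v /ft qv.
      by apply/exists_inP; exists q => //; move: qQt; rewrite inE => /andP[].
    move=> q q' qQt q'Qt eqf; have [fX ft] := fP q qQt.
    have [_ ft'] := fP q' q'Qt; rewrite -eqf in ft'.
    have /eqP/cards2P[y [y' [yy' E]]] := packing_trace PX fX.
    apply: (noaug (f q) q q' y y') => //; try by rewrite E !inE eqxx ?orbT.
    - by move: qQt; rewrite inE => /andP[].
    - by move: q'Qt; rewrite inE => /andP[].
    - by apply: ft; rewrite E !inE eqxx.
    - by apply: ft'; rewrite E !inE eqxx ?orbT.
  have sQ : \sum_(v in Q) p v = #|Q|%:R - #|Qt|%:R / 3.
    rewrite -!sum1_card !natr_sum mulr_suml.
    rewrite [X in _ - X](eq_bigl (fun q => (q \in Q) && tri q)); last first.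
      by move=> q; rewrite inE.
    rewrite [X in _ - X]big_mkcondr -sumrB; apply: eq_bigr => v vQ.
    by rewrite /p vQ; case: ifP => _; lra.
  (* An edge with both ends adjacent to [Q] has no [lone] end and pays 4/3; any other edge has at
     most one and pays at least 1. *)
  have sX : #|X|%:R + #|Xt|%:R / 3 <= \sum_(v in R :&: covered e X) p v.
    rewrite (sum_packing e_sym p PX) -!sum1_card !natr_sum mulr_suml.
    rewrite [X in _ + X <= _](eq_bigl (fun x => (x \in X) &&
      [forall v in N x :&: R, adj v])); last by move=> q; rewrite inE.
    rewrite [X in _ + X <= _]big_mkcondr -big_split; apply: ler_sum => x xX /=.
    have /eqP/cards2P[y [y' [yy' E]]] := packing_trace PX xX.
    have xR v : v \in N x :&: R -> v \in R /\ v \in N x by case/setIP.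
    have nQ v : v \in N x :&: R -> v \notin Q.
      case/xR => _ vx; rewrite in_setD negb_and negbK; apply/orP; left.
      by apply/coveredP; exists x.
    have yt : y \in N x :&: R by rewrite E !inE eqxx.
    have y't : y' \in N x :&: R by rewrite E !inE eqxx orbT.
    have loneN v w : v \in N x :&: R -> w \in N x :&: R -> v != w ->
        adj w -> ~~ lone v.
      move=> vt wt vw aw; apply/negP => /andP[_ /exists_inP[z zX /andP[vz /forall_inP vl]]].
      have [vR vx] := xR v vt.
      have ez := packing_inj e_sym PX zX xX vR vz vx; subst z.
      by have := vl w wt; rewrite aw /= eq_sym (negbTE vw).
    rewrite E big_setU1 ?inE //= big_set1 /p (negbTE (nQ y yt)) (negbTE (nQ y' y't)).
    case: ifP => [/forall_inP al|_].
      have ay : adj y by apply: al; rewrite -E.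
      have ay' : adj y' by apply: al; rewrite -E.
      rewrite (negbTE (loneN y y' yt y't yy' ay')).
      by rewrite eq_sym in yy'; rewrite (negbTE (loneN y' y y't yt yy' ay)); lra.
    case: (boolP (lone y)) => ly; last by case: (lone y'); lra.
    have ay : adj y by case/andP: ly.
    rewrite eq_sym in yy'; rewrite (negbTE (loneN y' y y't yt yy' ay)); lra.
  rewrite (big_setID (covered e X)) /= sQ.
  have cU : #|X :|: Q|%:R <= #|X|%:R + #|Q|%:R :> rat.
    by rewrite -natrD ler_nat cardsU leq_subr.
  have : #|Qt|%:R <= #|Xt|%:R :> rat by rewrite ler_nat.
  by move: sX cU; lra.
- move=> u; have := R2 u; case E: #|N u :&: R| => [|[|[|//]]] _.
  + by rewrite (cards0_eq E) big_set0 /reduced_harmonic harmonic0 /=; lra.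
  + have /eqP/cards1P[a ->] := E; rewrite big_set1 /reduced_harmonic.
    by rewrite harmonicS harmonic0 invr1 /=; have := ple a; lra.
  have /eqP/cards2P[a [b [ab Eab]]] := E.
  have -> : reduced_harmonic 2 = 4/3.
    by rewrite /reduced_harmonic !harmonicS harmonic0 invr1 /=; lra.
  rewrite Eab big_setU1 ?inE //= big_set1.
  (* If [c] has price 1, then [d] is matched, since [Q] contains no two-element trace. Were the
     other end of the edge of [d] adjacent to some [q] in [Q], then [q = c] by the augmentation
     argument, and [c] would be [tri]; so [d] is [lone]. *)
  have half c d : c != d -> N u :&: R = [set c; d] -> p c <= 2/3 \/ p d <= 1/3.
    move=> cd Ecd; rewrite {1}/p; case: ifP => [cQ|_]; last by left; case: ifP => _; lra.
    case: ifP => tc; [by left; lra|right].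
    have /setIP[cu cR] : c \in N u :&: R by rewrite Ecd !inE eqxx.
    have /setIP[du dR] : d \in N u :&: R by rewrite Ecd !inE eqxx orbT.
    have dQ : d \notin Q.
      apply/negP => dQ; have := Xleft u; rewrite leqNgt => /negP; apply.
      have <- : #|[set c; d]| = 2%N by rewrite cards2 cd.
      by apply/subset_leq_card; rewrite subUset !sub1set !in_setI cu du cQ dQ.
    have scd : share c d by apply/existsP; exists u; rewrite cu.
    have /coveredP[x xX dx] : d \in covered e X by move: dQ; rewrite in_setD dR andbT negbK.
    have dt : d \in N x :&: R by rewrite in_setI dx.
    suff ld : lone d by rewrite /p (negbTE dQ) ld.
    apply/andP; split; first by apply/exists_inP; exists c.
    apply/exists_inP; exists x => //; rewrite dx; apply/forall_inP => w wt.
    apply/implyP => /exists_inP[q qQ qw]; apply: contraFT tc => wd.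
    apply/exists_inP; exists x => //; apply/forall_inP => v vt.
    have eqc : c = q by apply: (noaug x c q d w) => //; rewrite eq_sym.
    have /setIP[dx' dR'] := dt; have /setIP[wx wR] := wt.
    rewrite eq_sym in wd.
    move: vt; rewrite (trace_pair wd dR wR dx wx) !inE.
    by case/orP => /eqP->; rewrite // eqc.
  have [pa|pb] := half a b ab Eab; last by have := ple a; lra.
  have := half b a; rewrite eq_sym setUC => /(_ ab Eab) [pb|pa'].
    by lra.
  by have := ple b; lra.
Qed.
End SmallTraces.
End GreedyPrices.

(** * Arithmetic of the reduced harmonic numbers *)

Lemma reduced_harmonic_step (i n : nat) :
  (i < n)%N -> (2 < n)%N ->
  reduced_harmonic i + n%:R^-1 <= reduced_harmonic i.+1.
Proof.
move=> lt_in lt2n; rewrite /reduced_harmonic harmonicS.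
have le_inv j : (0 < j)%N -> (j <= n)%N -> n%:R^-1 <= j%:R^-1 :> rat.
  by move=> j0 jn; rewrite lef_pV2 ?posrE ?ltr0n ?ler_nat //; lia.
(* The increments are 1, 1/3, 1/3, 1/4, 1/5 and so on; the second is 1/2 - 1/6, hence the condition
   that [n] is at least 3. *)
case: i lt_in => [|[|i]] lt_in.
- by rewrite /=; have := le_inv 1%N isT lt_in; lra.
- by rewrite /=; have := le_inv 3%N isT lt2n; lra.
- have [-> ->] : (1 < i.+2)%N = true /\ (1 < i.+3)%N = true by [].
  by have := le_inv i.+3 isT lt_in; move: (harmonic _) i.+3%:R^-1 => h y; lra.
Qed.

Lemma reduced_harmonic_add (i d n : nat) :
  (i + d <= n)%N -> (2 < n)%N ->
  reduced_harmonic i + d%:R / n%:R <= reduced_harmonic (i + d).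
Proof.
move=> + lt2n; elim: d => [|d IH]; first by rewrite addn0 mul0r addr0.
rewrite addnS => le_n; have := IH (ltnW le_n).
by have := reduced_harmonic_step le_n lt2n; rewrite -natr1 mulrDl mul1r; lra.
Qed.

Lemma reduced_harmonic_le (m n : nat) :
  (m <= n)%N -> reduced_harmonic m <= reduced_harmonic n.
Proof.
move=> le_mn; have := @reduced_harmonic_add m (n - m) n.+3.
rewrite subnKC // => /(_ _ isT) H; apply: le_trans (H _); last lia.
by rewrite lerDl divr_ge0 // ler0n.
Qed.

Lemma reduced_harmonic_harmonic (n : nat) :
  (5 <= n)%N -> reduced_harmonic n.+1 <= harmonic n.
Proof.
move=> le5n; rewrite /reduced_harmonic harmonicS ltnS.
have -> : (0 < n)%N by lia.
have : n.+1%:R^-1 <= 6^-1 :> rat by rewrite lef_pV2 ?posrE ?ltr0n // ler_nat.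
by move: (harmonic n) n.+1%:R^-1 => h y; rewrite /=; lra.
Qed.

(** Equality holds for [r] from 1 to 3: beyond a fixed charge of 2/3, such a trace costs 1/3 per
    vertex. *)
Lemma reduced_harmonic_linear (r : nat) :
  (r <= 3)%N -> reduced_harmonic r <= 2/3 + r%:R / 3.
Proof.
case: r => [|[|[|[|r]]]] lt_r; last by move: lt_r; rewrite ltnNge.
all: rewrite /reduced_harmonic ?harmonicS harmonic0 ?invr1 /=; lra.
Qed.

(** * Greedy phases for maximum degree at least 4 *)

Section GreedyPhases.
Variables (T : finType) (e : rel T).
Hypothesis e_sym : symmetric e.

Local Notation N := (cnbhd e).

Lemma priced_cover_phase (R X D : {set T}) (g : nat) (a p : T -> rat) :
  is_packing e R g X -> (forall v, 0 <= a v) ->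
  (forall x, x \in X -> 1 <= \sum_(v in N x :&: R) a v) ->
  priced_cover e (R :\: covered e X) D p ->
  priced_cover e R (X :|: D) (fun v => if v \in covered e X then a v else p v).
Proof.
move=> PX a0 aX [covD p0 leD]; split.
- apply/subsetP => v vR; rewrite coveredU in_setU.
  by case: (boolP (v \in covered e X)) => //= vX; apply: (subsetP covD); rewrite in_setD vX.
- by move=> v; case: ifP.
rewrite (big_setID (covered e X)) /=.
rewrite (eq_bigr a); last by move=> v /setIP[_ ->].
rewrite [X in _ <= _ + X](eq_bigr p); last by move=> v /setDP[_ /negbTE->].
rewrite (sum_packing e_sym a PX).
have : #|X|%:R <= \sum_(x in X) \sum_(v in N x :&: R) a v.
  by rewrite -sum1_card natr_sum; apply: ler_sum => x /aX.
have : #|X :|: D|%:R <= #|X|%:R + #|D|%:R :> rat.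
  by rewrite -natrD ler_nat cardsU leq_subr.
by move: leD; lra.
Qed.

Lemma sum_phase (A R C : {set T}) (a p : T -> rat) :
  \sum_(v in A :&: R) (if v \in C then a v else p v) =
  \sum_(v in A :&: R :&: C) a v + \sum_(v in A :&: (R :\: C)) p v.
Proof.
rewrite (big_setID C) /=; congr (_ + _); last rewrite setIDA.
  by apply: eq_bigr => v /setIP[_ ->].
by apply: eq_bigr => v /setDP[_ /negbTE->].
Qed.

(** The trace bound [g.+2] makes the edge cover the base case. In a phase with traces of size [g.+3]
    each covered vertex pays 1/(g+3), which the increments of [reduced_harmonic] up to that size
    dominate. *)
Lemma greedy_prices (g : nat) (R : {set T}) :
  (forall u, #|N u :&: R| <= g.+2)%N ->
  exists D p, priced_cover e R D p /\
    forall u, \sum_(v in N u :&: R) p v <= reduced_harmonic #|N u :&: R|.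
Proof.
elim: g R => [|g IH] R maxR; first exact: edge_cover_prices.
have [X [PX _ Xleft]] := maximum_packing e_sym maxR.
have [D [p [covD pD]]] := IH _ Xleft.
exists (X :|: D), (fun v => if v \in covered e X then g.+3%:R^-1 else p v); split.
  apply: (priced_cover_phase (a := fun=> g.+3%:R^-1) PX) => // [_|x xX].
    by rewrite invr_ge0 ler0n.
  by rewrite sumr_const (packing_trace PX xX) -[_ *+ _]mulr_natr mulVf ?pnatr_eq0.
move=> u; rewrite (sum_phase _ _ _ (fun=> g.+3%:R^-1)) sumr_const.
rewrite -[_ *+ _]mulr_natl addrC.
apply: le_trans (_ : reduced_harmonic (#|N u :&: (R :\: covered e X)| +
  #|N u :&: R :&: covered e X|) <= _).
  apply: le_trans (reduced_harmonic_add (n := g.+3) _ isT); first by rewrite lerD2r.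
  by rewrite addnC setIDA cardsID.
by rewrite addnC setIDA cardsID.
Qed.

Lemma harmonic_prices_ge5 :
  (5 <= max_degree e)%N ->
  exists D p, priced_cover e setT D p /\
    forall u, \sum_(v in N u) p v <= harmonic (max_degree e).
Proof.
(* The bound Δ + 1 on closed neighbourhoods is [g.+2] for [g] equal to Δ - 1. *)
move=> le5; have [|D [p [covD pD]]] := @greedy_prices (max_degree e).-1 setT.
  by move=> u; rewrite setIT prednK; [exact: card_cnbhd | lia].
exists D, p; split=> // u; have := pD u; rewrite setIT => /le_trans; apply.
apply: le_trans (reduced_harmonic_harmonic le5).
exact/reduced_harmonic_le/card_cnbhd.
Qed.

(* The vertices of degree 4 determine the prices: the constants make all the
   cases in the proof of [cheap_pair] tight. *)
Lemma harmonic_prices_4 :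
  max_degree e = 4%N ->
  exists D p, priced_cover e setT D p /\
    forall u, \sum_(v in N u) p v <= harmonic 4.
Proof.
move=> deg4.
have N5 u : (#|N u| <= 5)%N by rewrite -deg4 card_cnbhd.
have maxT u : (#|N u :&: setT| <= 5)%N by rewrite setIT.
have [X5 [P5 _ left5]] := maximum_packing e_sym maxT.
set C5 := covered e X5 in left5; rewrite setTD in left5.
set R5 := ~: C5 in left5.
have [X4 [P4 _ left4]] := maximum_packing e_sym left5.
have [D3 [p3 [cov3 sum3]]] := greedy_prices left4.
set C4 := covered e X4 in left4 cov3 sum3.
have X5C5 x : x \in X5 -> x \in C5.
  by move=> xX; apply/coveredP; exists x; rewrite ?cnbhd_refl.
have X4C4 x : x \in X4 -> x \in C4.
  by move=> xX; apply/coveredP; exists x; rewrite ?cnbhd_refl.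
(* a covered vertex and its dominator are both missing from its own trace *)
have X4R5 x : x \in X4 -> x \in R5.
  move=> xX; rewrite in_setC; apply/negP => /coveredP[d dX xd].
  have dC : d \in C5 by exact: X5C5.
  have xC : x \in C5 by apply/coveredP; exists d.
  have := packing_trace P4 xX.
  case: (eqVneq x d) => [E|xNd].
    have -> : N x :&: R5 = set0; last by rewrite cards0.
    apply/setP => v; rewrite !inE -in_cnbhd; apply/negP => /andP[vx /negP[]].
    by apply/coveredP; exists d => //; rewrite -E.
  have : N x :&: R5 \subset N x :\: [set x; d].
    apply/subsetP => v; rewrite in_setI in_setC in_setD in_set2 => /andP[-> vC].
    by rewrite andbT; apply: contra vC => /orP[] /eqP->.
  have sub2 : [set x; d] \subset N x.
    by rewrite subUset !sub1set cnbhd_refl cnbhd_sym.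
  move=> /subset_leq_card; rewrite cardsD (setIidPr sub2) cards2 xNd.
  by move: (N5 x) #|N x :&: R5|; move: #|N x|; clear; lia.
(* Each step is paid exactly: 2/9 + 4 * 7/36 = 1 for five vertices, 1/3 + 3 * 2/9 = 1 for four. *)
pose a5 v : rat := if v \in X5 then 2/9 else 7/36.
pose a4 v : rat := if v \in X4 then 1/3 else 2/9.
pose p4 v := if v \in C4 then a4 v else p3 v.
have cov4 : priced_cover e R5 (X4 :|: D3) p4.
  apply: (priced_cover_phase P4 _ _ cov3) => [v|x xX].
    by rewrite /a4; case: ifP => _; lra.
  have xt : x \in N x :&: R5 by rewrite in_setI cnbhd_refl X4R5.
  rewrite (big_setD1 x) //= {1}/a4 xX (eq_bigr (fun=> 2/9)); last first.
    move=> v /setD1P[vx /setIP[vNx vR]]; rewrite /a4; case: ifP => // vX.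
    by move: vx; rewrite (packing_inj e_sym P4 vX xX vR (cnbhd_refl _ _) vNx) eqxx.
  rewrite sumr_const; have := cardsD1 x (N x :&: R5).
  by rewrite (packing_trace P4 xX) xt add1n => -[<-]; lra.
have covT : priced_cover e setT (X5 :|: (X4 :|: D3))
    (fun v => if v \in C5 then a5 v else p4 v).
  apply: (priced_cover_phase P5) => [v|x xX|]; last by rewrite setTD.
    by rewrite /a5; case: ifP => _; lra.
  have xt : x \in N x :&: setT by rewrite in_setI cnbhd_refl inE.
  rewrite (big_setD1 x) //= {1}/a5 xX (eq_bigr (fun=> 7/36)); last first.
    move=> v /setD1P[vx /setIP[vNx vR]]; rewrite /a5; case: ifP => // vX.
    by move: vx; rewrite (packing_inj e_sym P5 vX xX vR (cnbhd_refl _ _) vNx) eqxx.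
  rewrite sumr_const; have := cardsD1 x (N x :&: setT).
  by rewrite (packing_trace P5 xX) xt add1n => -[<-]; lra.
exists (X5 :|: (X4 :|: D3)), (fun v => if v \in C5 then a5 v else p4 v).
split=> // u.
(* Vertices left to the last phases are counted at 1/3; their fixed charge of 2/3 is split off by
   [reduced_harmonic_linear]. *)
pose c v : rat := if v \in C5 then a5 v else if v \in C4 then a4 v else 1/3.
have cle v : c v <= 1/3.
  by rewrite /c /a5 /a4; do 2?case: ifP => _; try case: ifP => _; lra.
have -> : harmonic 4 = 25/12 by rewrite !harmonicS harmonic0 invr1; lra.
apply: le_trans (_ : 2/3 + \sum_(v in N u) c v <= _).
  have split_sum (q : T -> rat) :
      \sum_(v in N u) (if v \in C5 then a5 v else if v \in C4 then a4 v else q v) =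
      \sum_(v in N u :&: C5) a5 v + (\sum_(v in N u :&: R5 :&: C4) a4 v +
      \sum_(v in N u :&: (R5 :\: C4)) q v).
    rewrite -(sum_phase (N u) R5 C4 a4 q) /R5 -setTD.
    by rewrite -{2}[N u]setIT -(sum_phase (N u) setT C5 a5) setIT.
  rewrite (split_sum p3) (split_sum (fun=> 1/3)) sumr_const -[1/3 *+ _]mulr_natr.
  move: (le_trans (sum3 u) (reduced_harmonic_linear (left4 u))).
  move: (\sum_(v in _) a5 v) (\sum_(v in _) a4 v) (\sum_(v in _) p3 v) #|_|%:R.
  by clear=> s5 s4 s3 r; lra.
have sum_le (A : {set T}) : \sum_(v in A) c v <= #|A|%:R / 3.
  rewrite -sum1_card natr_sum mulr_suml; apply: ler_sum => v _.
  by have := cle v; lra.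
case: (leqP #|N u| 4) => [le4|lt4].
  have := sum_le (N u); have : #|N u|%:R <= 4%:R :> rat by rewrite ler_nat.
  by lra.
have cardN : #|N u| = 5%N by apply/eqP; rewrite eqn_leq N5.
(* The limit for five values of [c] is 25/12 - 2/3 = 51/36, and three of them total at most 36/36.
   The remaining 15/36 is 7/36 + 2/9. *)
have cheap_pair : exists v1 v2, [/\ v1 \in N u, v2 \in N u, v1 != v2 & c v1 + c v2 <= 15/36].
  have nbr_not_center x : x \in N u -> x != u -> x \in C5 -> u \notin C5 -> c x = 7/36.
    move=> xu xNu xC uC; rewrite /c xC /a5; case: ifP => // xX.
    by case/negP: uC; apply/coveredP; exists x; rewrite // cnbhd_sym.
  case: (boolP (u \in C5)) => uC5.
    have /coveredP[d dX ud] := uC5.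
    have dC := X5C5 d dX.
    case: (eqVneq u d) => [E|uNd].
      have /card_gt0P[v] : (0 < #|N u :\ u|)%N.
        by have := cardsD1 u (N u); rewrite cnbhd_refl cardN add1n => -[<-].
      case/setD1P => vNu vu; rewrite eq_sym in vNu.
      exists u, v; split; [exact: cnbhd_refl | exact: vu | exact: vNu | ].
      have vC : v \in C5 by apply/coveredP; exists d; rewrite // -E.
      have vX : v \in X5 = false.
        apply/negP => vX; case/eqP: vNu.
        by rewrite E in vu *; exact: esym (packing_inj e_sym P5 vX dX (in_setT v) (cnbhd_refl _ _) vu).
      by rewrite /c uC5 vC /a5 vX; case: ifP => _; lra.
    have du : d \in N u by rewrite cnbhd_sym.
    exists u, d; split; [exact: cnbhd_refl | exact: du | exact: uNd | ].
    have uX : u \in X5 = false.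
      apply/negP => uX; case/eqP: uNd.
      exact: (packing_inj e_sym P5 uX dX (in_setT u) (cnbhd_refl _ _) ud).
    by rewrite /c uC5 dC /a5 uX dX; lra.
  have [v1 v1u v1C] : exists2 v1, v1 \in N u & v1 \in C5.
    have /subsetPn[v1 v1u v1R] : ~~ (N u \subset R5).
      apply/negP => /setIidPl E; have := left5 u.
      by rewrite E cardN.
    by exists v1 => //; move: v1R; rewrite in_setC negbK.
  have v1Nu : v1 != u by apply: contraNneq uC5 => <-.
  have cv1 := nbr_not_center v1 v1u v1Nu v1C uC5.
  suff [v2 [v2u v21 cv2]] : exists v2, [/\ v2 \in N u, v1 != v2 & c v2 <= 2/9].
    by exists v1, v2; split; [by []| by []| by []| rewrite cv1; lra].
  case: (boolP (u \in C4)) => uC4.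
    have uR5 : u \in R5 by rewrite in_setC.
    have c4 v : v \in R5 -> v \in C4 -> v \notin X4 -> c v <= 2/9.
      by rewrite in_setC => /negbTE vC5 vC4 /negbTE vX; rewrite /c vC5 vC4 /a4 vX lexx.
    case: (boolP (u \in X4)) => uX; last first.
      by exists u; split; [exact: cnbhd_refl | exact: v1Nu | exact: c4].
    have /card_gt0P[v] : (0 < #|(N u :&: R5) :\ u|)%N.
      have := cardsD1 u (N u :&: R5); rewrite (packing_trace P4 uX).
      by rewrite in_setI cnbhd_refl uR5 add1n => -[<-].
    case/setD1P => vNu /setIP[vu vR]; exists v; split; first exact: vu.
      by apply/eqP => E; move: vR; rewrite in_setC -E v1C.
    apply: (c4 v vR); first by apply/coveredP; exists u.
    apply/negP => vX; case/eqP: vNu.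
    exact: (packing_inj e_sym P4 vX uX vR (cnbhd_refl _ _) vu).
  (* At most three of the five vertices of [N u] remain after both phases, so a second one is
     covered. It is no centre of its phase, since [u] is uncovered. *)
  have [v2 v2u /andP[v21 v2C]] : exists2 v2, v2 \in N u & (v1 != v2) && (v2 \in C5 :|: C4).
    have /subsetPn[v2] : ~~ (N u :\ v1 \subset R5 :\: C4).
      apply/negP => sub.
      have : N u :\ v1 \subset N u :&: (R5 :\: C4) by rewrite subsetI sub subsetDl.
      move/subset_leq_card; have := cardsD1 v1 (N u); rewrite v1u cardN add1n => -[<-].
      by rewrite leqNgt ltnS left4.
    case/setD1P => v21 v2u v2R; exists v2; first exact: v2u.
    rewrite eq_sym v21.
    by move: v2R; rewrite !inE negb_and !negbK orbC.
  exists v2; split; [exact: v2u | exact: v21 | ].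
  have v2Nu : v2 != u by apply: contraTneq v2C => ->; rewrite in_setU negb_or uC5.
  case: (boolP (v2 \in C5)) => v2C5.
    by rewrite (nbr_not_center v2 v2u v2Nu v2C5 uC5); lra.
  have v2C4 : v2 \in C4 by move: v2C; rewrite in_setU (negbTE v2C5).
  rewrite /c (negbTE v2C5) v2C4 /a4; case: ifP => [v2X|_]; last exact: lexx.
  case/negP: uC4.
  by apply/coveredP; exists v2; rewrite // cnbhd_sym.
have [v1 [v2 [v1u v2u v12 cc]]] := cheap_pair.
rewrite (big_setD1 v1 v1u) /= (big_setD1 v2) /=; last by rewrite in_setD1 eq_sym v12.
have := sum_le (N u :\ v1 :\ v2).
have -> : #|N u :\ v1 :\ v2| = 3%N; last by move: cc; lra.
have := cardsD1 v1 (N u); rewrite v1u cardN (cardsD1 v2 (N u :\ v1)).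
by rewrite in_setD1 eq_sym v12 v2u !add1n => -[<-].
Qed.
End GreedyPhases.

(** * Minimum partitions into stars *)

Section StarForests.
Variables (T : finType) (e : rel T).
Hypothesis e_sym : symmetric e.

Local Notation N := (cnbhd e).

(** A partition into stars, encoded as the idempotent map that sends each vertex to the centre of
    its star. *)
Definition star_map (c : {ffun T -> T}) : bool :=
  [forall v, (c (c v) == c v) && (c v \in N v)].

Definition centers (c : {ffun T -> T}) : {set T} := [set v | c v == v].

Definition star (c : {ffun T -> T}) (v : T) : {set T} := [set w | c w == c v].

Lemma star_mapP (c : {ffun T -> T}) :
  reflect (forall v, c (c v) = c v /\ c v \in N v) (star_map c).
Proof.
apply: (iffP forallP) => [cP v|cP v]; first by have /andP[/eqP] := cP v.
by have [-> ->] := cP v; rewrite eqxx.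
Qed.

Lemma in_star (c : {ffun T -> T}) (v w : T) : (w \in star c v) = (c w == c v).
Proof. by rewrite inE. Qed.

Lemma in_centers (c : {ffun T -> T}) (v : T) : (v \in centers c) = (c v == v).
Proof. by rewrite inE. Qed.

Lemma centers_dominating (c : {ffun T -> T}) :
  star_map c -> forall v, v \in covered e (centers c).
Proof.
move/star_mapP => cP v; have [cc cv] := cP v.
by apply/coveredP; exists (c v); rewrite ?in_centers ?cc // cnbhd_sym.
Qed.

Lemma dominating_star_map (D : {set T}) :
  (forall v, v \in covered e D) ->
  exists2 c, star_map c & (#|centers c| <= #|D|)%N.
Proof.
move=> domD.
pose f v := if v \in D then v else odflt v [pick x in D | v \in N x].
have fP v : f v \in D /\ f v \in N v.
  rewrite /f; case: ifP => [vD|_]; first by rewrite cnbhd_refl.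
  have /coveredP[x xD vx] := domD v.
  case: pickP => [y /andP[yD vy]|/(_ x)]; last by rewrite xD vx.
  by rewrite /= cnbhd_sym.
have fD v : v \in D -> f v = v by rewrite /f => ->.
exists [ffun v => f v].
  by apply/star_mapP => v; rewrite !ffunE; have [fvD fvN] := fP v; rewrite fD.
apply/subset_leq_card/subsetP => v; rewrite inE ffunE => /eqP <-.
by case: (fP v).
Qed.

Section MinimumStarMap.
Variable c : {ffun T -> T}.
Hypothesis cS : star_map c.
Hypothesis cmin : forall D : {set T},
  (forall v, v \in covered e D) -> (#|centers c| <= #|D|)%N.

Let cc (v : T) : c (c v) = c v. Proof. by case: (star_mapP _ cS v). Qed.

Let cN (v : T) : c v \in N v. Proof. by case: (star_mapP _ cS v). Qed.

(** Replacing the centres of the stars through [s] by [t] leaves a dominating set, so minimality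
    forbids a saving. Later rearrangements are refuted through an absurd [2 <= 1], [3 <= 2] or
    [4 <= 3] between list sizes. *)
Lemma star_swap (s t : seq T) :
  uniq (map c s) ->
  (forall x, x \in s -> forall w, c w = c x -> has (fun y => w \in N y) t) ->
  (size s <= size t)%N.
Proof.
move=> Us st; pose A := [set x in map c s].
have AC : A \subset centers c.
  by apply/subsetP => x; rewrite inE => /mapP[y _ ->]; rewrite inE cc.
have cA : #|A| = size s by rewrite cardsE (card_uniqP Us) size_map.
have ct : (#|[set y in t]| <= size t)%N by rewrite cardsE card_size.
have := cmin (D := (centers c :\: A) :|: [set y in t]).
have cardC : #|centers c :\: A| = (#|centers c| - size s)%N by rewrite cardsD (setIidPr AC) cA.
have leC : (size s <= #|centers c|)%N by rewrite -cA subset_leq_card.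
have cU := leq_card_setU (centers c :\: A) [set y in t].
move=> /(_ _) domD.
have /domD le1 : forall v, v \in covered e (centers c :\: A :|: [set y in t]).
  move=> v; case: (boolP (c v \in A)) => [|cvA].
    rewrite inE => /mapP[x xs /(st x xs)/hasP[y yt vy]].
    by apply/coveredP; exists y; rewrite // in_setU [_ \in [set _ in t]]inE yt orbT.
  apply/coveredP; exists (c v); last by rewrite cnbhd_sym.
  by rewrite in_setU in_setD cvA in_centers cc eqxx.
have := leq_trans le1 (leq_trans cU (leq_add (leqnn _) ct)).
by rewrite cardC; move: leC; clear; lia.
Qed.

Lemma in_star_refl (v : T) : v \in star c v. Proof. by rewrite in_star. Qed.

Lemma star_neighbour (v : T) :
  (1 < #|star c v|)%N -> exists m, [/\ m != v, m \in N v & c m = c v].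
Proof.
move=> big; case: (eqVneq (c v) v) => [cv|cv].
  have /card_gt0P[w /setD1P[wv]] : (0 < #|star c v :\ v|)%N.
    by have := cardsD1 v (star c v); rewrite in_star_refl; move: big; clear; lia.
  rewrite in_star => /eqP cw; exists w; split=> //.
  by rewrite cnbhd_sym // -{1}cv -cw.
by exists (c v); rewrite cc.
Qed.

Definition mate (v : T) : T := odflt v [pick w in star c v :\ v].

Lemma mateP (v : T) : #|star c v| = 2%N ->
  [/\ mate v != v, mate v \in N v, star c v = [set v; mate v],
      c (mate v) = c v & mate (mate v) = v].
Proof.
have card2 w : #|star c w| = 2%N ->
    [/\ mate w != w, mate w \in star c w & star c w = [set w; mate w]].
  move=> s2.
  have [mw ms] : mate w != w /\ mate w \in star c w.
    rewrite /mate; case: pickP => [x /setD1P[]//|none].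
    have := cardsD1 w (star c w); rewrite in_star_refl s2.
    by rewrite (eq_card0 none).
  split=> //; apply/esym/eqP; rewrite eqEcard s2 cards2 eq_sym mw andbT.
  by rewrite subUset !sub1set in_star_refl ms.
move=> s2; have [mv ms E] := card2 v s2.
have cm : c (mate v) = c v by apply/eqP; rewrite -in_star.
have Em : star c (mate v) = star c v by apply/setP => w; rewrite !in_star cm.
have s2m : #|star c (mate v)| = 2%N by rewrite Em.
have [mmv mms _] := card2 _ s2m.
split=> //.
  have /star_neighbour[w [wv wN cw]] : (1 < #|star c v|)%N by rewrite s2.
  have : w \in star c v by rewrite in_star cw.
  by rewrite E in_set2 (negbTE wv) /= => /eqP <-.
by move: mms; rewrite Em E in_set2 (negbTE mmv) orbF => /eqP.
Qed.

Lemma same_star (v w : T) :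
  #|star c v| = 2%N -> c w = c v -> (w == v) || (w == mate v).
Proof.
by move=> s2 cw; have [_ _ E _ _] := mateP s2; rewrite -in_set2 -E in_star cw.
Qed.

(* The pairs at u, b and d could be re-covered by the star of u together with
   the mates of b and d. This rearrangement is neutral, so it must leave no
   freedom at mate b; see [low_mate]. *)
Definition trio (u b : T) : bool :=
  [&& #|star c u| == 2, #|star c b| == 2, b \in N u, c b != c u &
      [exists d in N u, [&& #|star c d| == 2, c d != c u & d != b]]]%N.

(** In the prices for maximum degree 3, a low vertex cedes 1/12 to its mate. *)
Definition low (b : T) : bool := [exists u, trio u b].

Hypothesis nontrivial : forall v, (1 < #|N v|)%N -> (1 < #|star c v|)%N.

Lemma nontrivial_star (v w : T) : w \in N v -> w != v -> (1 < #|star c v|)%N.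
Proof.
move=> wv wNv; apply: nontrivial.
have <- : #|[set w; v]| = 2%N by rewrite cards2 wNv.
by apply/subset_leq_card; rewrite subUset !sub1set wv cnbhd_refl.
Qed.

(** If [p] lay in a pair, the pairs of [u], [b] and [d], together with that of [p] if it is a fourth
    one, could be covered with one vertex fewer. *)
Lemma low_mate (b p : T) :
  low b -> p \in N (mate b) -> c p != c b -> (2 < #|star c p|)%N.
Proof.
case/existsP => u /and5P[/eqP su /eqP sb bu cbu /exists_inP[d du /and3P[/eqP sd cdu db]]].
move=> pb' cpb; rewrite ltnNge; apply/negP => sp.
have [a_u aN _ ca _] := mateP su; have [b'b b'N _ cb' _] := mateP sb.
have [d'd d'N _ cd' _] := mateP sd.
have uu := cnbhd_refl e u; have dd := cnbhd_refl e d.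
have inS v := cnbhd_refl e v.
have b'p : mate b \in N p by rewrite cnbhd_sym.
have pb : mate b != p by apply: contra_neq cpb => <-.
have {}sp : #|star c p| = 2%N.
  by apply/eqP; rewrite eqn_leq sp (nontrivial_star b'p).
(* Otherwise [u] alone would cover its own pair and that of [b]. *)
have b'u : mate b \notin N u.
  apply/negP => b'u; suff : (2 <= 1)%N by [].
  apply: (star_swap (s := [:: u; b]) (t := [:: u])) => /=.
    by rewrite inE eq_sym cbu.
  move=> x; rewrite in_cons mem_seq1 => /orP[]/eqP-> w; rewrite orbF.
    by case/(same_star su)/orP => /eqP->.
  by case/(same_star sb)/orP => /eqP->.
have cdb : c d != c b.
  apply/eqP => /(same_star sb); rewrite (negbTE db) /= => /eqP E.
  by rewrite -E du in b'u.
have U3 : uniq (map c [:: u; b; d]).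
  by rewrite /= !inE negb_or !(eq_sym (c u)) cbu cdu eq_sym cdb.
have bb' : b \in N (mate b) by rewrite cnbhd_sym.
have dd' : d \in N (mate d) by rewrite cnbhd_sym.
have ud : u \in N d by rewrite cnbhd_sym.
have two (y z : T) :
    all (fun w => (w \in N y) || (w \in N z)) [:: u; mate u; b; mate b; d; mate d] ->
    False.
  move=> /allP cov; suff : (3 <= 2)%N by [].
  apply: (star_swap (s := [:: u; b; d]) (t := [:: y; z])) => //.
  move=> x; rewrite !in_cons in_nil orbF => /or3P[]/eqP-> w /=; rewrite orbF => cw; apply: cov.
  - by case/orP: (same_star su cw) => /eqP->; rewrite !inE eqxx ?orbT.
  - by case/orP: (same_star sb cw) => /eqP->; rewrite !inE eqxx ?orbT.
  - by case/orP: (same_star sd cw) => /eqP->; rewrite !inE eqxx ?orbT.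
case: (eqVneq (c p) (c u)) => [/(same_star su)/orP[]/eqP E|cpu].
- by rewrite -E b'p in b'u.
- by apply: (two (mate b) d); rewrite -E /= ?pb' ?bb' ?inS ?ud ?d'N ?orbT.
case: (eqVneq (c p) (c d)) => [/(same_star sd)/orP[]/eqP E|cpd].
- rewrite E in b'p; by apply: (two u d); rewrite /= ?b'p ?aN ?bu ?inS ?ud ?d'N ?orbT.
- rewrite E in b'p; by apply: (two u (mate d)); rewrite /= ?b'p ?aN ?bu ?inS ?du ?d'N ?orbT.
(* In the case of a fourth pair, [u] covers its mate, [b] and [d]; [p] covers its mate and [mate b];
   [mate d] covers itself. *)
suff : (4 <= 3)%N by [].
apply: (star_swap (s := [:: p; u; b; d]) (t := [:: u; mate d; p])).
  by rewrite map_cons cons_uniq U3 andbT /= !inE !negb_or cpu cpb cpd.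
have [_ p'N _ _ _] := mateP sp.
move=> x; rewrite !in_cons in_nil orbF => /or4P[]/eqP-> w /=; rewrite orbF.
- by case/(same_star sp)/orP => /eqP->; rewrite ?inS ?p'N ?orbT.
- by case/(same_star su)/orP => /eqP->; rewrite ?inS ?aN ?orbT.
- by case/(same_star sb)/orP => /eqP->; rewrite ?bu ?b'p ?orbT.
- by case/(same_star sd)/orP => /eqP->; rewrite ?du ?inS ?orbT.
Qed.
End MinimumStarMap.
End StarForests.

(** * Prices from stars for maximum degree at most 3 *)

Section StarPrices.
Variables (T : finType) (e : rel T).
Hypothesis e_sym : symmetric e.

Local Notation N := (cnbhd e).

(** Let [u] be a neighbour of a trivial star [v]. If [u] were a centre or in a star of two, it could
    serve as centre of both stars, saving one. So [u] is a leaf of a star of at least three; moving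
    it to [v] keeps the centres and removes a trivial star. *)
Lemma minimum_star_map :
  exists c, [/\ star_map e c,
    forall D, (forall v, v \in covered e D) -> (#|centers c| <= #|D|)%N
  & forall v, (1 < #|N v|)%N -> (1 < #|star c v|)%N].
Proof.
pose singles (c : {ffun T -> T}) := [set v | #|star c v| <= 1]%N.
(* The factor [#|T|.+1] exceeds every [#|singles c|], so [key] orders lexicographically. *)
pose key (c : {ffun T -> T}) := (#|centers c| * #|T|.+1 + #|singles c|)%N.
have id_star : star_map e [ffun v => v].
  by apply/star_mapP => v; rewrite !ffunE cnbhd_refl.
case: (arg_minnP key id_star) => c cS cmin_key.
have cmin (D : {set T}) : (forall v, v \in covered e D) -> (#|centers c| <= #|D|)%N.
  move=> /(dominating_star_map e_sym)[c' c'S le_c'D]; apply: leq_trans le_c'D.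
  have := cmin_key c' c'S; rewrite /key.
  move: (max_card (mem (singles c'))) #|singles c| #|centers c| #|centers c'|.
  by move: #|singles c'| #|T|; clear; nia.
exists c; split=> // v; apply: contraTT; rewrite -!leqNgt => sv1.
have cP := star_mapP _ _ cS.
have only w : c w = c v -> w = v.
  move=> cw; apply: (card_le1_eqP sv1); by rewrite in_star ?cw.
have cv : c v = v by apply: only; case: (cP v).
rewrite leqNgt; apply/negP => Nv.
have [u uNv uv] : exists2 u, u != v & u \in N v.
  have /card_gt0P[u /setD1P[uv uN]] : (0 < #|N v :\ v|)%N.
    by have := cardsD1 v (N v); rewrite cnbhd_refl; move: Nv; clear; lia.
  by exists u.
have vu : v \in N u by rewrite cnbhd_sym.
have cuv : c v != c u by apply: contra_neq uNv => /esym/only.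
have U2 : uniq (map c [:: v; u]) by rewrite /= mem_seq1 cuv.
have [ccu cuN] := cP u.
have noswap : ~ (forall w, c w = c u -> w \in N u).
  move=> cov; suff : (2 <= 1)%N by [].
  apply: (star_swap e_sym cS cmin (s := [:: v; u]) (t := [:: u])) => // x.
  rewrite in_cons mem_seq1 => /orP[]/eqP-> w /=; rewrite orbF; last exact: cov.
  by move/only->.
have cu : c u != u.
  by apply/eqP => cu; apply: noswap => w cw; rewrite cnbhd_sym // -{1}cu -cw; case: (cP w).
have big : (2 < #|star c u|)%N.
  rewrite ltnNge; apply/negP => s2; apply: noswap => w cw.
  have sub : [set u; c u] \subset star c u by rewrite subUset !sub1set !in_star ccu eqxx.
  have : w \in [set u; c u].
    suff -> : [set u; c u] = star c u by rewrite in_star cw.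
    by apply/eqP; rewrite eqEcard sub cards2 eq_sym cu.
  by rewrite in_set2 => /orP[]/eqP->; rewrite ?cnbhd_refl.
pose c' := [ffun w => if w == u then v else c w].
have c'u : c' u = v by rewrite ffunE eqxx.
have c'N w : w != u -> c' w = c w by rewrite ffunE => /negbTE->.
have vNu : v != u by rewrite eq_sym.
have c'v : c' v = v by rewrite c'N.
have cNu w : c w != u.
  by apply/eqP => cw; case/eqP: cu; rewrite -{1}cw; case: (cP w) => ->.
have c'S : star_map e c'.
  apply/star_mapP => w; case: (eqVneq w u) => [->|wu]; first by rewrite c'u c'v.
  by rewrite (c'N w wu) c'N //; case: (cP w).
have eqC : centers c' = centers c.
  apply/setP => w; rewrite !in_centers.
  by case: (eqVneq w u) => [->|/c'N->//]; rewrite c'u (negbTE vNu) (negbTE cu).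
have := cmin_key c' c'S; rewrite /key eqC leq_add2l leqNgt => /negP; apply.
apply: proper_card; apply/properP; split; last first.
  exists v; first by rewrite inE.
  rewrite inE -ltnNge; have <- : #|[set u; v]| = 2%N by rewrite cards2 uNv.
  by apply: subset_leq_card; rewrite subUset !sub1set !in_star c'u c'v eqxx.
(* No trivial star is created: the star that loses [u] keeps at least two vertices. *)
apply/subsetP => w; rewrite !inE => sw.
have star_le (A : {set T}) : (forall x, x \in A -> c' x = c' w) -> (#|A| <= 1)%N.
  move=> AP; apply: leq_trans sw; apply: subset_leq_card; apply/subsetP => x /AP.
  by rewrite in_star => ->.
have wu : w != u.
  apply/eqP => wu; suff : (#|[set u; v]| <= 1)%N by rewrite cards2 uNv.
  by apply: star_le => x /set2P[]->; rewrite ?wu c'u ?c'v.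
have cwu : c w != c u.
  apply/eqP => cw; suff : (#|star c u :\ u| <= 1)%N.
    by move: big; rewrite (cardsD1 u (star c u)) in_star eqxx; clear; lia.
  apply: star_le => x /setD1P[xu]; rewrite in_star => /eqP cx.
  by rewrite !c'N // cx cw.
apply: star_le => x; rewrite in_star => /eqP cx; rewrite !c'N //.
by apply: contra_neq cwu => <-.
Qed.

Lemma centers_le_prices (c : {ffun T -> T}) (p : T -> rat) :
  star_map e c -> (forall v, 1 <= \sum_(w in star c v) p w) ->
  #|centers c|%:R <= \sum_(v in setT) p v.
Proof.
move=> /star_mapP cP p1.
rewrite (partition_big c (mem (centers c))) /=; last first.
  by move=> v _; rewrite in_centers; case: (cP v) => ->.
rewrite -sum1_card natr_sum; apply: ler_sum => x xC; apply: le_trans (p1 x) _.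
rewrite le_eqVlt; apply/orP; left; apply/eqP; apply: eq_bigl => w.
by rewrite in_star in_setT; move: xC; rewrite in_centers => /eqP->.
Qed.

Lemma priced_cover_centers (c : {ffun T -> T}) (p : T -> rat) :
  star_map e c -> (forall v, 0 <= p v) ->
  (forall v, 1 <= \sum_(w in star c v) p w) ->
  priced_cover e setT (centers c) p.
Proof.
move=> cS p0 p1; split=> //; last exact: centers_le_prices.
by apply/subsetP => v _; exact: centers_dominating.
Qed.

Lemma card_star_gt0 (c : {ffun T -> T}) (v : T) : (0 < #|star c v|)%N.
Proof. by apply/card_gt0P; exists v; rewrite in_star. Qed.

Lemma isolated_cnbhd (c : {ffun T -> T}) (u : T) :
  (forall v, (1 < #|N v|)%N -> (1 < #|star c v|)%N) ->
  (#|star c u| <= 1)%N -> N u = [set u].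
Proof.
move=> nontriv su; apply/esym/eqP; rewrite eqEcard sub1set cnbhd_refl cards1.
by rewrite leqNgt; apply: contraTN su => /nontriv; rewrite ltnNge.
Qed.

(** (Δ + 1)/2 equals H(Δ) for Δ = 1 and Δ = 2. A trivial star pays 1, but its vertex is isolated, so
    this price occurs in no other closed neighbourhood. *)
Lemma harmonic_prices_le2 :
  (1 <= max_degree e <= 2)%N ->
  exists D p, priced_cover e setT D p /\
    forall u, \sum_(v in N u) p v <= harmonic (max_degree e).
Proof.
move=> degs; have deg12 : max_degree e = 1%N \/ max_degree e = 2%N.
  by case: (max_degree e) degs => [|[|[|//]]] // _; [left | right].
have [c [cS _ nontriv]] := minimum_star_map.
pose p v : rat := if (#|star c v| <= 1)%N then 1 else 1/2.
have p_star v w : c w = c v -> p w = p v by move=> cw; rewrite /p /star cw.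
exists (centers c), p; split.
  apply: priced_cover_centers => // v; first by rewrite /p; case: ifP => _; lra.
  rewrite (eq_bigr (fun=> p v)); last by move=> w; rewrite in_star => /eqP/p_star.
  rewrite sumr_const -[_ *+ _]mulr_natr /p; case: leqP => [_|lt1].
    by rewrite mul1r ler1n card_star_gt0.
  have : 2%:R <= #|star c v|%:R :> rat by rewrite ler_nat.
  by move: #|_|%:R => r; lra.
have H1 : 1 <= harmonic (max_degree e).
  by case: deg12 => ->; rewrite !harmonicS harmonic0 invr1; lra.
move=> u; case: (leqP #|star c u| 1) => [su|su].
  by rewrite (isolated_cnbhd nontriv su) big_set1 /p su.
rewrite (eq_bigr (fun=> 1/2)); last first.
  move=> v vu; rewrite /p; case: leqP => // sv.
  move: su; rewrite cnbhd_sym // in vu; move: vu.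
  by rewrite (isolated_cnbhd nontriv sv) in_set1 => /eqP->; rewrite ltnNge sv.
rewrite sumr_const -[_ *+ _]mulr_natr.
have : #|N u|%:R <= (max_degree e).+1%:R :> rat by rewrite ler_nat card_cnbhd.
move: #|N u|%:R => r.
by case: deg12 => ->; rewrite !harmonicS harmonic0 invr1; lra.
Qed.

(** A vertex in a star of at least three sees two prices 1/3 and at most two others. A vertex in a
    pair pays 1 together with its mate, which leaves 5/6 for two others; two prices 1/2 would be too
    much, but then both these vertices are [low]. *)
Lemma harmonic_prices_3 :
  max_degree e = 3%N ->
  exists D p, priced_cover e setT D p /\
    forall u, \sum_(v in N u) p v <= harmonic 3.
Proof.
move=> deg3; have [c [cS cmin nontriv]] := minimum_star_map.
have N4 u : (#|N u| <= 4)%N by rewrite -deg3 card_cnbhd.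
have lowM := low_mate e_sym cS cmin nontriv.
(* The shift 1/12 is tight both ways: 1/3 + 1/3 + 7/12 + 7/12 = 11/6 and 1 + 5/12 + 5/12 = 11/6. *)
pose ind (b : bool) : rat := if b then 1/12 else 0.
pose p v : rat := if (#|star c v| <= 1)%N then 1 else
  if #|star c v| == 2 then 1/2 - ind (low e c v) + ind (low e c (mate c v)) else 1/3.
have ind0 b : 0 <= ind b <= 1/12 by rewrite /ind; case: b; apply/andP; split; lra.
have eq_star v w : c w = c v -> star c w = star c v.
  by move=> cw; apply/setP => x; rewrite !in_star cw.
have p2 v : #|star c v| = 2%N -> p v = 1/2 - ind (low e c v) + ind (low e c (mate c v)).
  by move=> sv; rewrite /p sv.
have p3 v : (2 < #|star c v|)%N -> p v = 1/3.
  move=> sv; rewrite /p leqNgt (ltn_trans _ sv) //=; case: eqP => // s2.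
  by rewrite s2 in sv.
have p_pair v : #|star c v| = 2%N -> p v + p (mate c v) = 1.
  move=> sv; have [_ _ _ cm mm] := mateP e_sym cS sv.
  by rewrite (p2 v sv) (p2 (mate c v)) ?mm; [lra | rewrite (eq_star _ _ cm)].
have p_le v : (1 < #|star c v|)%N -> 0 <= p v <= 7/12.
  move=> sv; rewrite /p leqNgt sv /=; case: ifP => _; last by apply/andP; split; lra.
  move: (ind0 (low e c v)) (ind0 (low e c (mate c v))).
  by move=> /andP[? ?] /andP[? ?]; apply/andP; split; lra.
have p0 v : 0 <= p v.
  case: (leqP #|star c v| 1) => [sv|/p_le/andP[]//]; by rewrite /p sv ler01.
exists (centers c), p; split.
  apply: priced_cover_centers => // v.
  case: (ltngtP #|star c v| 2) => sv.
  - have E : star c v = [set v].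
      by apply/esym/eqP; rewrite eqEcard sub1set in_star eqxx cards1 -ltnS sv.
    by rewrite E big_set1 /p -ltnS sv lexx.
  - rewrite (eq_bigr (fun=> 1/3)); last first.
      by move=> w; rewrite in_star => /eqP/eq_star E; rewrite p3 ?E.
    rewrite sumr_const -[_ *+ _]mulr_natr.
    have : 3%:R <= #|star c v|%:R :> rat by rewrite ler_nat.
    by move: #|_|%:R => r; lra.
  - have [mv _ E _ _] := mateP e_sym cS sv.
    rewrite E big_setU1 /= ?big_set1 ?p_pair ?lexx //.
    by rewrite in_set1 eq_sym.
have -> : harmonic 3 = 11/6 by rewrite !harmonicS harmonic0 invr1; lra.
move=> u; case: (leqP #|star c u| 1) => [su|su].
  by rewrite (isolated_cnbhd nontriv su) big_set1 /p su; lra.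
have nbr_star v : v \in N u -> (1 < #|star c v|)%N.
  move=> vu; rewrite ltnNge; apply/negP => sv.
  move: su; rewrite cnbhd_sym // in vu; move: vu.
  by rewrite (isolated_cnbhd nontriv sv) in_set1 => /eqP->; rewrite ltnNge sv.
have split_sum m : m \in N u -> m != u ->
    \sum_(v in N u) p v = p u + p m + \sum_(v in N u :\ u :\ m) p v /\
    (#|N u :\ u :\ m| <= 2)%N.
  move=> mu mNu; have mD : m \in N u :\ u by rewrite in_setD1 mNu.
  split.
    by rewrite (big_setD1 u) ?cnbhd_refl //= (big_setD1 m) //= addrA.
  have := N4 u; rewrite (cardsD1 u) cnbhd_refl (cardsD1 m (N u :\ u)) mD.
  by clear; lia.
case: (ltnP 2 #|star c u|) => [s3|s2].
  have [m [mNu mu cm]] := star_neighbour e_sym cS su.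
  have [-> O2] := split_sum m mu mNu.
  rewrite (p3 u s3) (p3 m); last by rewrite (eq_star _ _ cm).
  have : \sum_(v in N u :\ u :\ m) p v <= \sum_(v in N u :\ u :\ m) 7/12.
    by apply: ler_sum => v /setD1P[_ /setD1P[_ /nbr_star/p_le/andP[]]].
  rewrite sumr_const -[7/12 *+ _]mulr_natr.
  have : #|N u :\ u :\ m|%:R <= 2%:R :> rat by rewrite ler_nat.
  by move: #|_|%:R (\sum_(v in _) _) => r s; clear; lra.
have {}su : #|star c u| = 2%N by apply/eqP; rewrite eqn_leq s2 su.
have [mNu mu Estar _ _] := mateP e_sym cS su.
have [-> O2] := split_sum _ mu mNu.
rewrite (p_pair u su).
set O := N u :\ u :\ mate c u in O2 *.
have inO g : g \in O -> [/\ g \in N u, c g != c u & (1 < #|star c g|)%N].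
  case/setD1P => gm /setD1P[gu gN]; split=> //; last exact: nbr_star.
  by rewrite -in_star Estar in_set2 negb_or gu gm.
(* If [mate g] were low, [low_mate] would put [u], a neighbour of [g], into a star of at least
   three. *)
have high_mate g : g \in O -> #|star c g| = 2%N -> low e c (mate c g) = false.
  move=> gO sg; have [gN cgu _] := inO g gO; case lg: (low _ _ _) => //.
  have [_ _ _ cm mm] := mateP e_sym cS sg.
  have := lowM (mate c g) u lg; rewrite mm cm cnbhd_sym // gN eq_sym cgu.
  by move=> /(_ isT isT); rewrite su.
have p_half g : g \in O -> p g <= 1/2.
  move=> gO; have [_ _ sg] := inO g gO.
  case: (ltngtP #|star c g| 2) => sg'; first by rewrite ltnS leqNgt sg in sg'.
    by rewrite p3 //; lra.
  rewrite p2 // (high_mate g gO sg') /ind; case: ifP => _; lra.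
suff : \sum_(v in O) p v <= 5/6 by clear; lra.
have third g h : g \in O -> h \in O -> g != h -> p g + p h <= 5/6.
  move=> gO hO gh; have [gN cgu sg] := inO g gO; have [hN chu sh] := inO h hO.
  case: (eqVneq #|star c g| 2%N) => sg2; last first.
    by rewrite (p3 g); [have := p_half h hO; lra | rewrite ltn_neqAle eq_sym sg2].
  case: (eqVneq #|star c h| 2%N) => sh2; last first.
    by rewrite (p3 h); [have := p_half g gO; lra | rewrite ltn_neqAle eq_sym sh2].
  have lg : low e c g.
    apply/existsP; exists u; rewrite /trio su sg2 gN cgu /=.
    by apply/exists_inP; exists h; rewrite // sh2 chu eq_sym gh.
  have lh : low e c h.
    apply/existsP; exists u; rewrite /trio su sh2 hN chu /=.
    by apply/exists_inP; exists g; rewrite // sg2 cgu gh.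
  rewrite (p2 g sg2) (p2 h sh2) lg lh (high_mate g gO sg2) (high_mate h hO sh2) /ind.
  lra.
case E: #|O| O2 => [|[|[|//]]] _.
- by rewrite (cards0_eq E) big_set0; lra.
- have /eqP/cards1P[g Eg] := E; rewrite Eg big_set1.
  by have := p_half g; rewrite Eg in_set1 eqxx => /(_ isT); lra.
have /eqP/cards2P[g [h [gh Egh]]] := E.
rewrite Egh big_setU1 ?in_set1 //= big_set1.
by apply: third => //; rewrite Egh in_set2 eqxx ?orbT.
Qed.
End StarPrices.

(** * Covers and duality *)

Lemma harmonic_prices (T : finType) (e : rel T) :
  symmetric e -> (1 <= max_degree e)%N ->
  exists D p, priced_cover e setT D p /\
    forall u, \sum_(v in cnbhd e u) p v <= harmonic (max_degree e).
Proof.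
move=> e_sym deg1; case: (leqP 5 (max_degree e)) => [deg5|deg4].
  exact: harmonic_prices_ge5.
case: (leqP (max_degree e) 2) => deg2.
  by apply: harmonic_prices_le2; rewrite ?deg1.
have [deg3|{}deg4] : max_degree e = 3%N \/ max_degree e = 4%N.
  by move: deg2 deg4; clear; lia.
  by rewrite deg3; exact: harmonic_prices_3.
by rewrite deg4; exact: harmonic_prices_4.
Qed.

(** Each vertex over [v] chooses a dominator in [S], which lies over the closed neighbourhood of
    [v]. The choice is injective because [pi] is injective on closed neighbourhoods. *)
Lemma cover_dominating_weight (TF TG : finType) (eF : rel TF) (eG : rel TG)
    (pi : TG -> TF) (k : nat) (S : {set TG}) (v : TF) :
  simple_graph eF -> symmetric eG -> is_kfold_cover k eG eF pi ->
  dominating eG S ->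
  (k <= \sum_(u in cnbhd eF v) #|[set s in S | pi s == u]|)%N.
Proof.
move=> [symF irrF] symG [[_ cov] fib] /(dominatingP symG) domS.
have piN s g : g \in cnbhd eG s -> pi g \in cnbhd eF (pi s).
  rewrite !in_cnbhd => /orP[/eqP->|esg]; first by rewrite eqxx.
  have [_ im] := cov s; have : pi g \in pi @: nbhd eG s by rewrite imset_f // inE.
  by rewrite im inE => ->; rewrite orbT.
have -> : (\sum_(u in cnbhd eF v) #|[set s in S | pi s == u]| =
    #|[set s in S | pi s \in cnbhd eF v]|)%N.
  rewrite -[RHS]sum1_card (partition_big pi (mem (cnbhd eF v))) /=; last first.
    by move=> s; rewrite inE => /andP[].
  apply: eq_bigr => u uv; rewrite -sum1_card; apply: eq_bigl => s.
  rewrite [in LHS]inE [s \in [set _ in S | _]]inE.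
  by case: eqP => [->|_]; rewrite ?andbF // uv !andbT.
rewrite -(fib v).
pose f g := odflt g [pick s in S | g \in cnbhd eG s].
have fP g : f g \in S /\ g \in cnbhd eG (f g).
  rewrite /f; have /coveredP[s sS gs] := domS g.
  by case: pickP => [t /andP[]//|/(_ s)]; rewrite sS gs.
have pi_inj s g g' : g \in cnbhd eG s -> g' \in cnbhd eG s -> pi g = pi g' -> g = g'.
  (* Irreflexivity of [eF] extends injectivity from open to closed neighbourhoods. *)
  have nbr_neq t : eG s t -> pi t <> pi s.
    move=> est E; have [_ im] := cov s.
    have : pi t \in pi @: nbhd eG s by rewrite imset_f // inE.
    by rewrite im inE E irrF.
  rewrite !in_cnbhd => /orP[/eqP->|eg] /orP[/eqP->|eg'] // E.
  - by have := nbr_neq _ eg'; rewrite -E.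
  - by have := nbr_neq _ eg; rewrite E.
  - by have [inj _] := cov s; apply: inj; rewrite ?inE.
rewrite -(card_in_imset (f := f)).
  apply/subset_leq_card/subsetP => s /imsetP[g]; rewrite inE => /eqP <- ->.
  by have [fS gf] := fP g; rewrite in_set fS (cnbhd_sym symF) piN.
move=> g g'; rewrite !inE => /eqP pg /eqP pg' E.
by apply: (pi_inj (f g)); [case: (fP g) | rewrite E; case: (fP g') | rewrite pg].
Qed.

Theorem theorem2p4 (TF TG : finType) (eF : rel TF) (eG : rel TG)
  (pi : TG -> TF) (k : nat) :
  simple_graph eF -> simple_graph eG ->
  (1 <= max_degree eF)%N ->
  is_kfold_cover k eG eF pi ->
  (domination_number eG)%:R >=
    (harmonic (max_degree eF))^-1 * (k%:R * (domination_number eF)%:R) :> rat.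
Proof.
move=> simpF [symG _] deg1 cov; have symF := simpF.1.
have [S domS <-] := domination_number_attained eG.
have [D [p [[covD p0 leD] pH]]] := harmonic_prices symF deg1.
set H := harmonic _ in pH *.
have H0 : 0 < H.
  rewrite /H; case: (max_degree eF) deg1 => // n _; rewrite harmonicS.
  rewrite ltr_wpDl ?invr_gt0 ?ltr0n // /harmonic sumr_ge0 // => i _.
  by rewrite invr_ge0 ler0n.
pose w u := #|[set s in S | pi s == u]|.
have sum_w : (\sum_u w u = #|S|)%N.
  rewrite -[RHS]sum1_card (partition_big pi predT) //=.
  by apply: eq_bigr => u _; rewrite /w -sum1_card; apply: eq_bigl => s; rewrite inE.
rewrite ler_pdivrMl //.
(* Weak duality: the products [w u * p v] over [u] in the closed neighbourhood of [v] are summed in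
   both orders, giving at least [k] times the total price and at most [H] times [#|S|]. *)
apply: le_trans (_ : k%:R * \sum_v p v <= _).
  rewrite ler_wpM2l ?ler0n //.
  have -> : \sum_v p v = \sum_(v in setT) p v by apply: eq_bigl => v; rewrite in_setT.
  apply: le_trans leD; rewrite ler_nat domination_number_le //.
  by apply/(dominatingP symF) => v; apply: (subsetP covD).
apply: le_trans (_ : \sum_v \sum_(u in cnbhd eF v) (w u)%:R * p v <= _).
  rewrite mulr_sumr; apply: ler_sum => v _; rewrite -mulr_suml ler_wpM2r //.
  by rewrite -natr_sum ler_nat; exact: (cover_dominating_weight v simpF symG cov domS).
rewrite (exchange_big_dep predT) //= -sum_w natr_sum mulr_sumr.
apply: ler_sum => u _; rewrite -mulr_sumr mulrC ler_wpM2r ?ler0n //.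
apply: le_trans (pH u); rewrite le_eqVlt; apply/orP; left; apply/eqP.
by apply: eq_bigl => v; rewrite cnbhd_sym.
Qed.
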